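(* Let $k$ be an algebraically closed field of characteristic zero, let $H$ be a semisimple Hopf algebra over $k$, and let $K \subseteq H$ be a Hopf subalgebra. If $K$ is a depth two subalgebra of $H$, then $K$ is a normal Hopf subalgebra of $H$.
   Context: Depth two: let $B$ be a unital subring of a ring $A$. The extension $A \mid B$ is right depth two if $A \otimes_B A$ is isomorphic, as a natural $A$-$B$-bimodule, to a direct summand of $A^n$ for some positive integer $n$; it is left depth two if $A \otimes_B A$ is isomorphic, as a natural $B$-$A$-bimodule, to a direct summand of $A^n$ for some positive integer $n$. It is depth two if it is both left and right depth two. Normal Hopf subalgebra: a Hopf subalgebra $K$ of a semisimple Hopf algebra $H$ (with antipode $S$ and comultiplication $\Delta(a) = a_{(1)} \otimes a_{(2)}$ in Sweedler notation) is normal if $S(a_{(1)}) K a_{(2)} \subseteq K$ for all $a \in H$. Equivalently, $a_{(1)} K S(a_{(2)}) \subseteq K$ for all $a \in H$; equivalently, $HK^+ = K^+H$, where $K^+$ is the kernel of the counit of $K$. *)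

(* Defs.v *)
From HB Require Import structures.
From mathcomp Require Import all_boot all_algebra.
From mathcomp Require Import boolp.
From mathcomp.multinomials Require Import freeg.

Set Implicit Arguments.
Unset Strict Implicit.
Unset Printing Implicit Defensive.

Import GRing.Theory.
Import Quotient.

Local Open Scope ring_scope.
Local Open Scope quotient_scope.

(* M (x)_R N as the free abelian group on M * N modulo the balanced relations.
   Only the actions [ra] of R on the right of M and [la] on the left of N
   matter, so that R may be a noncommutative ring, or a subring given as a
   sigma-type. *)
Section BalancedTensor.

Variables (R : Type) (M N : zmodType) (ra : M -> R -> M) (la : R -> N -> N).

Inductive tensor_rel : {freeg (M * N)%type} -> Prop :=
  | Tensor_rel0 : tensor_rel 0
  | Tensor_relB u v : tensor_rel u -> tensor_rel v -> tensor_rel (u - v)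
  | Tensor_relDl x x' y :
      tensor_rel (<< (x + x', y) >> - << (x, y) >> - << (x', y) >>)
  | Tensor_relDr x y y' :
      tensor_rel (<< (x, y + y') >> - << (x, y) >> - << (x, y') >>)
  | Tensor_relA x r y : tensor_rel (<< (ra x r, y) >> - << (x, la r y) >>).

Definition tensor_relb (u : {freeg (M * N)%type}) : bool := `[< tensor_rel u >].

Lemma tensor_relb_zmod_closed : zmod_closed tensor_relb.
Proof.
split; first by apply/asboolP; exact: Tensor_rel0.
by move=> u v /asboolP hu /asboolP hv; apply/asboolP; exact: Tensor_relB.
Qed.

HB.instance Definition _ :=
  GRing.isZmodClosed.Build _ tensor_relb tensor_relb_zmod_closed.

Definition tensor_kernel : zmodClosed {freeg (M * N)%type} :=
  GRing.ZmodClosed.clone _ tensor_relb _.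

Definition tensor := Quotient.quot tensor_kernel.

HB.instance Definition _ := GRing.Zmodule.on tensor.
HB.instance Definition _ := EqQuotient.on tensor.

Definition pure (x : M) (y : N) : tensor := \pi_tensor << (x, y) >>.

Definition balanced (V : zmodType) (f : M -> N -> V) :=
  [/\ forall y, {morph f^~ y : x x' / x + x'},
      forall x, {morph f x : y y' / y + y'} &
      forall x r y, f (ra x r) y = f x (la r y)].

(* The map induced by f on the tensor product, i.e. the Sweedler-type
   expression sum f t_(1) t_(2); it is meaningful only when f is balanced,
   see [tlift_pure] and [tlift_is_zmod_morphism]. *)
Definition tlift (V : zmodType) (f : M -> N -> V) (t : tensor) : V :=
  fglift (fun p : M * N => f p.1 p.2 : zmodule V) (repr t).

Lemma tensor_eqP (u v : {freeg (M * N)%type}) :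
  tensor_rel (u - v) <-> \pi_tensor u = \pi_tensor v.
Proof.
split=> [h|/eqP h].
  by apply/eqP; rewrite -(idealrBE tensor_kernel); apply/asboolP.
by apply/asboolP; rewrite -[X in is_true X]/((u - v) \in tensor_kernel)
  idealrBE.
Qed.

Lemma tlift_pi (V : zmodType) (f : M -> N -> V) u :
  balanced f ->
  tlift f (\pi_tensor u) = fglift (fun p : M * N => f p.1 p.2 : zmodule V) u.
Proof.
case=> fDl fDr fA; apply/eqP; rewrite -subr_eq0.
set F := fglift _; rewrite /tlift -/F; set w := repr _.
have FB : zmod_morphism F by exact: lift_is_additive.
have F0 : F 0 = 0 by rewrite -[X in F X](subrr 0) FB subrr.
have FU p : F << p >> = f p.1 p.2 by rewrite /F liftU scale1r.
have: tensor_rel (w - u) by apply/tensor_eqP; rewrite reprK.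
rewrite -[X in X == 0]/(F w - F u) -FB.
elim: (w - u) / => [|u1 v _ /eqP hu _ /eqP hv|x x' y|x y y'|x r y]; apply/eqP.
- exact: F0.
- by rewrite FB hu hv subr0.
- by rewrite !FB !FU /= fDl addrAC addrK subrr.
- by rewrite !FB !FU /= fDr addrAC addrK subrr.
- by rewrite !FB !FU /= fA subrr.
Qed.

Lemma tlift_pure (V : zmodType) (f : M -> N -> V) x y :
  balanced f -> tlift f (pure x y) = f x y.
Proof. by move=> fb; rewrite tlift_pi // liftU scale1r. Qed.

Lemma pi_tensorB : zmod_morphism (\pi_tensor).
Proof. exact: (raddfB (\pi_(Quotient.quot tensor_kernel))). Qed.

HB.instance Definition _ :=
  GRing.isZmodMorphism.Build {freeg (M * N)%type} tensor (\pi_tensor)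
    pi_tensorB.

Lemma tlift_is_zmod_morphism (V : zmodType) (f : M -> N -> V) :
  balanced f -> zmod_morphism (tlift f).
Proof.
move=> fb s t; rewrite -[s]reprK -[t]reprK -pi_tensorB !tlift_pi //.
exact: (lift_is_additive (fun p : M * N => f p.1 p.2 : zmodule V)).
Qed.

Lemma tliftD (V : zmodType) (f : M -> N -> V) :
  balanced f -> {morph tlift f : s t / s + t}.
Proof.
move=> /tlift_is_zmod_morphism fB s t.
have f0 : tlift f 0 = 0 by rewrite -[X in tlift f X](subrr 0) fB subrr.
by rewrite -[t in LHS]opprK fB -[- t]sub0r fB f0 sub0r opprK.
Qed.

Lemma tlift0 (V : zmodType) (f : M -> N -> V) : balanced f -> tlift f 0 = 0.
Proof.
move=> /tlift_is_zmod_morphism fB.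
by rewrite -[X in tlift f X](subrr 0) fB subrr.
Qed.

Lemma pureDl x x' y : pure (x + x') y = pure x y + pure x' y.
Proof.
apply/eqP; rewrite -subr_eq0 opprD addrA -!pi_tensorB; apply/eqP.
by rewrite -[RHS](raddf0 (\pi_tensor)); apply/tensor_eqP; rewrite subr0;
  exact: Tensor_relDl.
Qed.

Lemma pureDr x y y' : pure x (y + y') = pure x y + pure x y'.
Proof.
apply/eqP; rewrite -subr_eq0 opprD addrA -!pi_tensorB; apply/eqP.
by rewrite -[RHS](raddf0 (\pi_tensor)); apply/tensor_eqP; rewrite subr0;
  exact: Tensor_relDr.
Qed.

Lemma pureA x r y : pure (ra x r) y = pure x (la r y).
Proof. by apply/tensor_eqP; exact: Tensor_relA. Qed.

Lemma pure_balanced : balanced pure.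
Proof.
split=> [y x x'|x y y'|x r y]; [exact: pureDl|exact: pureDr|exact: pureA].
Qed.

Lemma tensor_ind (P : tensor -> Prop) :
  P 0 -> (forall s t, P s -> P t -> P (s + t)) -> (forall x y, P (pure x y)) ->
  forall t, P t.
Proof.
move=> P0 PD Pp t; rewrite -[t]reprK.
have pureN x y : pure (- x) y = - pure x y.
  apply/eqP; rewrite -addr_eq0 -pureDl addNr.
  by apply/eqP/(addIr (pure 0 y)); rewrite -pureDl !add0r.
have Pn x y n : P (pure x y *+ n)
  by elim: n => // n IH; rewrite mulrS; exact: PD.
move: (repr t) => u; apply: (@freeg_ind_dom0 _ _ (fun u => P (\pi_tensor u)))
  => [|c [x y] {}u _ _ IH]; first by rewrite raddf0.
rewrite raddfD; apply: PD IH.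
suff [n [->|->]] : exists n : nat, << c *g (x, y) >> = << (x, y) >> *+ n
    \/ << c *g (x, y) >> = - << (x, y) >> *+ n :> {freeg (M * N)%type}.
- by rewrite raddfMn; exact: Pn.
- by rewrite raddfMn raddfN -[- _]pureN; exact: Pn.
case: c => n; [exists n; left | exists n.+1; right].
  by rewrite freeg_muln natz.
by rewrite mulNrn freeg_muln freegUN natz NegzE.
Qed.

End BalancedTensor.

Arguments pure {R M N ra la} x y.
Arguments tlift {R M N ra la V} f t.
Arguments balanced {R M N} ra la {V} f.

Section TensorOverRing.

Variable k : comNzRingType.
Implicit Types M N P : lmodType k.

Definition tens M N :=
  tensor (fun (x : M) (c : k) => c *: x) (fun (c : k) (y : N) => c *: y).

HB.instance Definition _ M N := GRing.Zmodule.on (tens M N).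

Definition tpure M N (x : M) (y : N) : tens M N := pure x y.

Definition bilin_balanced M N (V : zmodType) (f : M -> N -> V) :=
  balanced (fun (x : M) (c : k) => c *: x) (fun (c : k) (y : N) => c *: y) f.

Definition tens_scale M N (c : k) (t : tens M N) : tens M N :=
  tlift (fun x y => tpure (c *: x) y) t.

Lemma tpureZ M N c (x : M) (y : N) : tpure (c *: x) y = tpure x (c *: y).
Proof. exact: pureA. Qed.

Lemma tens_scale_balanced M N c :
  bilin_balanced (fun (x : M) (y : N) => tpure (c *: x) y).
Proof.
split=> [y x x'|x y y'|x r y].
- by rewrite scalerDr /tpure pureDl.
- by rewrite /tpure pureDr.
- by rewrite scalerA mulrC -scalerA tpureZ.
Qed.

Lemma tens_scale_pure M N c (x : M) (y : N) :
  tens_scale c (tpure x y) = tpure (c *: x) y.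
Proof. by rewrite /tens_scale tlift_pure //; exact: tens_scale_balanced. Qed.

Lemma tens_scaleDr M N c : {morph @tens_scale M N c : s t / s + t}.
Proof. by apply: tliftD; exact: tens_scale_balanced. Qed.

Lemma tens_scale0r M N c : @tens_scale M N c 0 = 0.
Proof. by apply: tlift0; exact: tens_scale_balanced. Qed.

Lemma tens_scaleA M N (a b : k) (t : tens M N) :
  tens_scale a (tens_scale b t) = tens_scale (a * b) t.
Proof.
elim/tensor_ind: t => [|s t hs ht|x y].
- by rewrite !tens_scale0r.
- by rewrite !tens_scaleDr hs ht.
- by rewrite !tens_scale_pure scalerA.
Qed.

Lemma tens_scale1 M N (t : tens M N) : tens_scale 1 t = t.
Proof.
elim/tensor_ind: t => [|s t hs ht|x y].
- by rewrite tens_scale0r.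
- by rewrite tens_scaleDr hs ht.
- by rewrite tens_scale_pure scale1r.
Qed.

Lemma tens_scaleDl M N (t : tens M N) :
  {morph (fun c => tens_scale c t) : a b / a + b}.
Proof.
move=> a b /=; elim/tensor_ind: t => [|s t hs ht|x y].
- by rewrite !tens_scale0r addr0.
- by rewrite !tens_scaleDr hs ht addrACA.
- by rewrite !tens_scale_pure scalerDl /tpure pureDl.
Qed.

HB.instance Definition _ M N := GRing.Zmodule_isLmodule.Build k (tens M N)
  (@tens_scaleA M N) (@tens_scale1 M N) (@tens_scaleDr M N) (@tens_scaleDl M N).

Definition tmap M M' N N' (f : M -> M') (g : N -> N') (t : tens M N) :
  tens M' N' := tlift (fun x y => tpure (f x) (g y)) t.

(* (M (x) N) (x) P -> M (x) (N (x) P) *)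
Definition tassoc M N P (t : tens (tens M N) P) : tens M (tens N P) :=
  tlift (fun s z => tlift (fun x y => tpure x (tpure y z)) s) t.

Lemma tmap_balanced M M' N N' (f : {linear M -> M'}) (g : {linear N -> N'}) :
  bilin_balanced (fun x y => tpure (f x) (g y)).
Proof.
split=> [y x x'|x y y'|x r y].
- by rewrite raddfD /tpure pureDl.
- by rewrite raddfD /tpure pureDr.
- by rewrite !linearZ tpureZ.
Qed.

Lemma tmap_pure M M' N N' (f : {linear M -> M'}) (g : {linear N -> N'}) x y :
  tmap f g (tpure x y) = tpure (f x) (g y).
Proof. by rewrite /tmap tlift_pure //; exact: tmap_balanced. Qed.

Lemma tassoc_balanced1 M N P (z : P) :
  bilin_balanced (fun (x : M) (y : N) => tpure x (tpure y z)).
Proof.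
split=> [y x x'|x y y'|x r y].
- by rewrite /tpure pureDl.
- by rewrite /tpure pureDl pureDr.
- by rewrite tpureZ; congr tpure; exact: tens_scale_pure.
Qed.

Lemma tassoc_balanced M N P :
  bilin_balanced (fun (s : tens M N) (z : P) =>
    tlift (fun x y => tpure x (tpure y z)) s).
Proof.
split=> [z s s'|s z z'|s r z].
- by rewrite tliftD //; exact: tassoc_balanced1.
- elim/tensor_ind: s => [|s t hs ht|x y].
  + by rewrite !tlift0 ?addr0 //; exact: tassoc_balanced1.
  + rewrite !tliftD; try exact: tassoc_balanced1.
    by rewrite hs ht addrACA.
  + rewrite !tlift_pure; try exact: tassoc_balanced1.
    by rewrite /tpure !pureDr.
- elim/tensor_ind: s => [|s t hs ht|x y].
  + by rewrite scaler0 !tlift0 //; exact: tassoc_balanced1.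
  + rewrite scalerDr !tliftD; try exact: tassoc_balanced1.
    by rewrite hs ht.
  + rewrite [_ *: _]tens_scale_pure !tlift_pure; try exact: tassoc_balanced1.
    rewrite tpureZ; congr tpure; rewrite -tpureZ; exact: tens_scale_pure.
Qed.

Lemma tassoc_pure M N P (x : M) (y : N) (z : P) :
  tassoc (tpure (tpure x y) z) = tpure x (tpure y z).
Proof.
rewrite /tassoc tlift_pure; last exact: tassoc_balanced.
by rewrite tlift_pure //; exact: tassoc_balanced1.
Qed.

End TensorOverRing.

Section TensorAlgebra.

Variables (k : comNzRingType) (A B : algType k).

Definition tens_one : tens A B := tpure 1 1.

(* (a (x) b) (c (x) d) = ac (x) bd *)
Definition tens_mul (s t : tens A B) : tens A B :=
  tlift (fun a b => tlift (fun c d => tpure (a * c) (b * d)) t) s.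

Lemma tens_mul_balanced1 (a : A) (b : B) :
  bilin_balanced (fun (c : A) (d : B) => tpure (a * c) (b * d)).
Proof.
split=> [y x x'|x y y'|x r y].
- by rewrite mulrDr /tpure pureDl.
- by rewrite mulrDr /tpure pureDr.
- by rewrite -!scalerAr tpureZ.
Qed.

Lemma tens_mul_balanced (t : tens A B) :
  bilin_balanced (fun (a : A) (b : B) =>
    tlift (fun c d => tpure (a * c) (b * d)) t).
Proof.
split=> [b a a'|a b b'|a r b]; elim/tensor_ind: t => [|s t hs ht|c d];
  rewrite ?tlift0 ?addr0 //; try exact: tens_mul_balanced1.
- rewrite !tliftD; try exact: tens_mul_balanced1.
  by rewrite hs ht addrACA.
- rewrite !tlift_pure; try exact: tens_mul_balanced1.
  by rewrite mulrDl /tpure pureDl.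
- rewrite !tliftD; try exact: tens_mul_balanced1.
  by rewrite hs ht addrACA.
- rewrite !tlift_pure; try exact: tens_mul_balanced1.
  by rewrite mulrDl /tpure pureDr.
- rewrite !tliftD; try exact: tens_mul_balanced1.
  by rewrite hs ht.
- rewrite !tlift_pure; try exact: tens_mul_balanced1.
  by rewrite -!scalerAl tpureZ.
Qed.

Lemma tens_mul_pure (a c : A) (b d : B) :
  tens_mul (tpure a b) (tpure c d) = tpure (a * c) (b * d).
Proof.
rewrite /tens_mul tlift_pure; last exact: tens_mul_balanced.
by rewrite tlift_pure //; exact: tens_mul_balanced1.
Qed.

Lemma tens_mulDl : left_distributive tens_mul +%R.
Proof. by move=> s s' t; apply: tliftD; exact: tens_mul_balanced. Qed.

Lemma tens_mul0r : left_zero 0 tens_mul.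
Proof. by move=> t; apply: tlift0; exact: tens_mul_balanced. Qed.

Lemma tens_mulr0 : right_zero 0 tens_mul.
Proof.
move=> s; elim/tensor_ind: s => [|s t hs ht|a b]; first exact: tens_mul0r.
  by rewrite tens_mulDl hs ht addr0.
rewrite /tens_mul tlift_pure; last exact: tens_mul_balanced.
by apply: tlift0; exact: tens_mul_balanced1.
Qed.

Lemma tens_mulDr : right_distributive tens_mul +%R.
Proof.
move=> s t t'; elim/tensor_ind: s => [|s s' hs hs'|a b].
- by rewrite !tens_mul0r addr0.
- by rewrite !tens_mulDl hs hs' addrACA.
rewrite /tens_mul !tlift_pure; try exact: tens_mul_balanced.
by apply: tliftD; exact: tens_mul_balanced1.
Qed.

Lemma tens_mulA : associative tens_mul.
Proof.
move=> s t u; elim/tensor_ind: s => [|s s' hs hs'|a b].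
- by rewrite !tens_mul0r.
- by rewrite !tens_mulDl hs hs'.
elim/tensor_ind: t => [|t t' ht ht'|c d].
- by rewrite tens_mulr0 !tens_mul0r tens_mulr0.
- by rewrite tens_mulDl !tens_mulDr tens_mulDl ht ht'.
elim/tensor_ind: u => [|u u' hu hu'|e f].
- by rewrite !tens_mulr0.
- by rewrite !tens_mulDr hu hu'.
by rewrite !tens_mul_pure !mulrA.
Qed.

Lemma tens_mul1r : left_id tens_one tens_mul.
Proof.
move=> t; elim/tensor_ind: t => [|s t hs ht|a b]; first exact: tens_mulr0.
  by rewrite tens_mulDr hs ht.
by rewrite tens_mul_pure !mul1r.
Qed.

Lemma tens_mulr1 : right_id tens_one tens_mul.
Proof.
move=> t; elim/tensor_ind: t => [|s t hs ht|a b]; first exact: tens_mul0r.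
  by rewrite tens_mulDl hs ht.
by rewrite tens_mul_pure !mulr1.
Qed.

HB.instance Definition _ := GRing.Zmodule_isPzRing.Build (tens A B)
  tens_mulA tens_mul1r tens_mulr1 tens_mulDl tens_mulDr.

End TensorAlgebra.

HB.mixin Record Algebra_isHopf (k : fieldType) H of GRing.Algebra k H := {
  comul : {linear H -> tens H H};
  counit : {linear H -> k | *%R};
  antipode : {linear H -> H};
  comul_monoid_morphism : monoid_morphism comul;
  counit_monoid_morphism : monoid_morphism counit;
  coassoc : forall h : H,
    tassoc (tmap comul idfun (comul h)) = tmap idfun comul (comul h);
  counitl : forall h : H, tlift (fun a b => counit a *: b) (comul h) = h;
  counitr : forall h : H, tlift (fun a b => counit b *: a) (comul h) = h;
  antipodel : forall h : H,
    tlift (fun a b => antipode a * b) (comul h) = (counit h)%:A;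
  antipoder : forall h : H,
    tlift (fun a b => a * antipode b) (comul h) = (counit h)%:A
}.

#[short(type="hopfAlgType")]
HB.structure Definition HopfAlgebra (k : fieldType) :=
  {H of GRing.Algebra k H & Algebra_isHopf k H}.

Definition direct_sum (V : zmodType) (P Q : {pred V}) :=
  (forall x, x \in P -> x \in Q -> x = 0) /\
  (forall x, exists p q, [/\ p \in P, q \in Q & x = p + q]).

(* Left ideals of A are the submodules of the regular left module A^o. *)
Definition semisimple (A : nzRingType) :=
  forall I : {pred A^o}, submod_closed I ->
  exists J : {pred A^o}, submod_closed J /\ direct_sum I J.

Record bimodule (A : nzRingType) := Bimodule {
  bimod_sort :> zmodType;
  lact : A -> bimod_sort -> bimod_sort;
  ract : bimod_sort -> A -> bimod_sort;
  lactDr : forall a, {morph lact a : x y / x + y};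
  lactDl : forall x, {morph lact^~ x : a b / a + b};
  lactA : forall a b x, lact a (lact b x) = lact (a * b) x;
  lact1 : forall x, lact 1 x = x;
  ractDl : forall a, {morph ract^~ a : x y / x + y};
  ractDr : forall x, {morph ract x : a b / a + b};
  ractA : forall a b x, ract (ract x a) b = ract x (a * b);
  ract1 : forall x, ract x 1 = x;
  lractA : forall a b x, ract (lact a x) b = lact a (ract x b)
}.

(* An A-A-bimodule is regarded as an L-R-bimodule for subrings L and R of A;
   this is how both the A-B- and the B-A-bimodules below arise. *)
Section RestrictedBimodules.

Variables (A : nzRingType) (L R : {pred A}).

Definition subbimodule (M : bimodule A) (P : {pred M}) :=
  [/\ zmod_closed P,
      {in L, forall a, {in P, forall x, lact a x \in P}} &
      {in R, forall a, {in P, forall x, ract x a \in P}}].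

Definition bimodule_hom (M N : bimodule A) (f : M -> N) :=
  [/\ {morph f : x y / x + y},
      {in L, forall a x, f (lact a x) = lact a (f x)} &
      {in R, forall a x, f (ract x a) = ract (f x) a}].

Definition iso_direct_summand (M N : bimodule A) :=
  exists P Q : {pred N},
    [/\ subbimodule P, subbimodule Q, direct_sum P Q &
        exists f : M -> N,
          [/\ bimodule_hom f, injective f &
              forall y, y \in P <-> exists x, y = f x]].

End RestrictedBimodules.

Section PowerBimodule.

Variables (A : nzRingType) (n : nat).

Definition power_lact (a : A) (v : {ffun 'I_n -> A}) : {ffun 'I_n -> A} :=
  [ffun i => a * v i].
Definition power_ract (v : {ffun 'I_n -> A}) (a : A) : {ffun 'I_n -> A} :=
  [ffun i => v i * a].

Lemma power_lactDr a : {morph power_lact a : u v / u + v}.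
Proof. by move=> u v; apply/ffunP=> i; rewrite !ffunE mulrDr. Qed.

Lemma power_lactDl u : {morph power_lact^~ u : a b / a + b}.
Proof. by move=> a b; apply/ffunP=> i; rewrite !ffunE mulrDl. Qed.

Lemma power_lactA a b u : power_lact a (power_lact b u) = power_lact (a * b) u.
Proof. by apply/ffunP=> i; rewrite !ffunE mulrA. Qed.

Lemma power_lact1 u : power_lact 1 u = u.
Proof. by apply/ffunP=> i; rewrite !ffunE mul1r. Qed.

Lemma power_ractDl a : {morph power_ract^~ a : u v / u + v}.
Proof. by move=> u v; apply/ffunP=> i; rewrite !ffunE mulrDl. Qed.

Lemma power_ractDr u : {morph power_ract u : a b / a + b}.
Proof. by move=> a b; apply/ffunP=> i; rewrite !ffunE mulrDr. Qed.

Lemma power_ractA a b u : power_ract (power_ract u a) b = power_ract u (a * b).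
Proof. by apply/ffunP=> i; rewrite !ffunE mulrA. Qed.

Lemma power_ract1 u : power_ract u 1 = u.
Proof. by apply/ffunP=> i; rewrite !ffunE mulr1. Qed.

Lemma power_lractA a b u :
  power_ract (power_lact a u) b = power_lact a (power_ract u b).
Proof. by apply/ffunP=> i; rewrite !ffunE mulrA. Qed.

Definition power_bimodule : bimodule A :=
  Bimodule power_lactDr power_lactDl power_lactA power_lact1
    power_ractDl power_ractDr power_ractA power_ract1 power_lractA.

End PowerBimodule.

Section TensorSquareBimodule.

Variables (A : nzRingType) (B : {pred A}).

Definition tensor_over : Type :=
  tensor (fun (x : A) (b : {b : A | b \in B}) => x * val b)
         (fun (b : {b : A | b \in B}) (y : A) => val b * y).

HB.instance Definition _ := GRing.Zmodule.on tensor_over.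

Definition tensor_over_pure (x y : A) : tensor_over := pure x y.

Definition tensor_over_lact (a : A) (t : tensor_over) : tensor_over :=
  tlift (fun x y => tensor_over_pure (a * x) y) t.
Definition tensor_over_ract (t : tensor_over) (a : A) : tensor_over :=
  tlift (fun x y => tensor_over_pure x (y * a)) t.

Lemma tensor_over_lact_balanced a :
  balanced (fun (x : A) (b : {b : A | b \in B}) => x * val b)
    (fun (b : {b : A | b \in B}) (y : A) => val b * y)
    (fun x y => tensor_over_pure (a * x) y).
Proof.
split=> [y x x'|x y y'|x r y].
- by rewrite mulrDr /tensor_over_pure pureDl.
- by rewrite /tensor_over_pure pureDr.
- by rewrite mulrA /tensor_over_pure pureA.
Qed.

Lemma tensor_over_ract_balanced a :
  balanced (fun (x : A) (b : {b : A | b \in B}) => x * val b)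
    (fun (b : {b : A | b \in B}) (y : A) => val b * y)
    (fun x y => tensor_over_pure x (y * a)).
Proof.
split=> [y x x'|x y y'|x r y].
- by rewrite /tensor_over_pure pureDl.
- by rewrite mulrDl /tensor_over_pure pureDr.
- by rewrite -mulrA /tensor_over_pure pureA.
Qed.

Lemma tensor_over_lact_pure a x y :
  tensor_over_lact a (tensor_over_pure x y) = tensor_over_pure (a * x) y.
Proof.
by rewrite /tensor_over_lact tlift_pure //; exact: tensor_over_lact_balanced.
Qed.

Lemma tensor_over_ract_pure a x y :
  tensor_over_ract (tensor_over_pure x y) a = tensor_over_pure x (y * a).
Proof.
by rewrite /tensor_over_ract tlift_pure //; exact: tensor_over_ract_balanced.
Qed.

Lemma tensor_over_lactD a : {morph tensor_over_lact a : s t / s + t}.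
Proof. by apply: tliftD; exact: tensor_over_lact_balanced. Qed.

Lemma tensor_over_ractD a : {morph tensor_over_ract^~ a : s t / s + t}.
Proof. by apply: tliftD; exact: tensor_over_ract_balanced. Qed.

Lemma tensor_over_lact0 a : tensor_over_lact a 0 = 0.
Proof. by apply: tlift0; exact: tensor_over_lact_balanced. Qed.

Lemma tensor_over_ract0 a : tensor_over_ract 0 a = 0.
Proof. by apply: tlift0; exact: tensor_over_ract_balanced. Qed.

Lemma tensor_over_lactDl t :
  {morph tensor_over_lact^~ t : a b / a + b}.
Proof.
move=> a b; elim/tensor_ind: t => [|s t hs ht|x y].
- by rewrite !tensor_over_lact0 addr0.
- by rewrite !tensor_over_lactD hs ht addrACA.
- by rewrite !tensor_over_lact_pure mulrDl /tensor_over_pure pureDl.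
Qed.

Lemma tensor_over_lactA a b t :
  tensor_over_lact a (tensor_over_lact b t) = tensor_over_lact (a * b) t.
Proof.
elim/tensor_ind: t => [|s t hs ht|x y].
- by rewrite !tensor_over_lact0.
- by rewrite !tensor_over_lactD hs ht.
- by rewrite !tensor_over_lact_pure mulrA.
Qed.

Lemma tensor_over_lact1 t :
  tensor_over_lact 1 t = t.
Proof.
elim/tensor_ind: t => [|s t hs ht|x y].
- by rewrite tensor_over_lact0.
- by rewrite tensor_over_lactD hs ht.
- by rewrite tensor_over_lact_pure mul1r.
Qed.

Lemma tensor_over_ractDr t :
  {morph tensor_over_ract t : a b / a + b}.
Proof.
move=> a b; elim/tensor_ind: t => [|s t hs ht|x y].
- by rewrite !tensor_over_ract0 addr0.
- by rewrite !tensor_over_ractD hs ht addrACA.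
- by rewrite !tensor_over_ract_pure mulrDr /tensor_over_pure pureDr.
Qed.

Lemma tensor_over_ractA a b t :
  tensor_over_ract (tensor_over_ract t a) b = tensor_over_ract t (a * b).
Proof.
elim/tensor_ind: t => [|s t hs ht|x y].
- by rewrite !tensor_over_ract0.
- by rewrite !tensor_over_ractD hs ht.
- by rewrite !tensor_over_ract_pure mulrA.
Qed.

Lemma tensor_over_ract1 t :
  tensor_over_ract t 1 = t.
Proof.
elim/tensor_ind: t => [|s t hs ht|x y].
- by rewrite tensor_over_ract0.
- by rewrite tensor_over_ractD hs ht.
- by rewrite tensor_over_ract_pure mulr1.
Qed.

Lemma tensor_over_lractA a b t :
  tensor_over_ract (tensor_over_lact a t) b =
  tensor_over_lact a (tensor_over_ract t b).
Proof.
elim/tensor_ind: t => [|s t hs ht|x y].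
- by rewrite !(tensor_over_lact0, tensor_over_ract0).
- by rewrite !(tensor_over_lactD, tensor_over_ractD) hs ht.
- by rewrite !(tensor_over_lact_pure, tensor_over_ract_pure).
Qed.

(* A (x)_B A with a.(x (x) y).c = ax (x) yc *)
Definition tensor_square_bimodule : bimodule A :=
  Bimodule tensor_over_lactD tensor_over_lactDl tensor_over_lactA
    tensor_over_lact1 tensor_over_ractD tensor_over_ractDr tensor_over_ractA
    tensor_over_ract1 tensor_over_lractA.

End TensorSquareBimodule.

Arguments tensor_over_pure {A B} x y.

Section DepthTwo.

Variables (A : nzRingType) (B : {pred A}).

Definition right_depth_two := exists2 n : nat, (0 < n)%N &
  iso_direct_summand predT B (tensor_square_bimodule B) (power_bimodule A n).

Definition left_depth_two := exists2 n : nat, (0 < n)%N &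
  iso_direct_summand B predT (tensor_square_bimodule B) (power_bimodule A n).

Definition depth_two := left_depth_two /\ right_depth_two.

End DepthTwo.

Section HopfSubalgebra.

Variables (k : fieldType) (H : hopfAlgType k).

(* The image of K (x) K in H (x) H; since k is a field, K (x) K embeds. *)
Definition tens_sub (K : {pred H}) (t : tens H H) :=
  exists s : seq (H * H),
    all (fun p => (p.1 \in K) && (p.2 \in K)) s /\
    t = \sum_(p <- s) tpure p.1 p.2.

Definition hopf_subalgebra (K : {pred H}) :=
  [/\ subalg_closed K,
      {in K, forall x, tens_sub K (comul x)} &
      {in K, forall x, antipode x \in K}].

(* S(a_(1)) K a_(2) is contained in K for all a *)
Definition normal_hopf_subalgebra (K : {pred H}) :=
  hopf_subalgebra K /\
  forall a : H, {in K, forall x,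
    tlift (fun a1 a2 => antipode a1 * x * a2) (comul a) \in K}.

End HopfSubalgebra.

(* Main.v *)
(* Write e for the counit, and let G : H -> V satisfy G (u b) = e(b) G u for
   all b in K. Then x (x) y |-> e(y) G x is defined on H (x)_K H, and evaluating
   it on a splitting of H (x)_K H in H^n as a K-H-bimodule gives
   G (b u) = e(b) G u as well; this is the inclusion K^+ H <= H K^+.
   Suppose that p : H -> K is a right K-linear retraction. Applying the previous
   remark to G u = p (h u_1) S(u_2) yields
   p (h x a) = p (h a_1) S(a_2) x a_3 for x in K, hence
   p (S(a_1) x a_2) = S(a_1) x a_2, and this element lies in K.
   For the existence of p, the normalized integral of the semisimple algebra H
   gives a separability idempotent, so H is finite dimensional; if r : H -> K is
   any linear projection and g_h(x) = r (h x_1) S(x_2), then p h is the partial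
   trace over K of the map x |-> S(g_h(x)_1) (x) g_h(x)_2. *)

Require Import Defs.
From HB Require Import structures.
From mathcomp Require Import all_boot all_algebra.
From mathcomp Require Import boolp classical_sets.
From mathcomp.multinomials Require Import freeg.

Set Implicit Arguments.
Unset Strict Implicit.
Unset Printing Implicit Defensive.

Import GRing.Theory.

Local Open Scope ring_scope.

(** * Linear algebra over a field: separating functionals and finite coordinates *)

Lemma linear_bundle (k : pzRingType) (V W : lmodType k) (f : V -> W) :
  linear f -> exists g : {linear V -> W}, g =1 f.
Proof.
move=> fL; pose m := GRing.isLinear.Build k V W *:%R f fL.
by exists (HB.pack f m : {linear V -> W}).
Qed.

Section LinearAlgebra.

Variables (k : fieldType) (V : lmodType k).

(** By Zorn's lemma some subspace is maximal among those containing [P] and missing [v]. It is a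
    complement of the line through [v], and the functional is the projection onto that line. *)
Lemma exists_separating_functional (P : {pred V}) (v : V) :
  submod_closed P -> v \notin P ->
  exists f : {linear V -> k^o}, {in P, forall w, f w = 0} /\ f v = 1.
Proof.
case=> P0 Plin vP.
(* Joining [P] to [A] takes care of the empty chain in [Zorn_bigcup], whose union is empty but
   extends to [P]. *)
pose ext (A : set V) := fun x => x \in P \/ A x.
pose ok (A : set V) :=
  (forall a x y, ext A x -> ext A y -> ext A (a *: x + y)) /\ ~ ext A v.
have [F Fok Ftot|A [[Alin Av] Amax]] := @Zorn_bigcup V ok.
  split=> [a x y|[/idP|[A FA Av]]]; last 2 first.
  - exact/negP.
  - by have [_] := Fok _ FA; apply; right.
  have mon A B x' : F A -> subset A B -> ext A x' -> ext B x'.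
    by move=> _ AB [|/AB]; [left|right].
  have up A : F A -> forall x' y', ext A x' -> ext A y' ->
      ext (bigcup F id) (a *: x' + y').
    move=> FA x' y' hx hy; have [lin _] := Fok _ FA.
    by case: (lin a _ _ hx hy) => h; [left|right; exists A].
  case=> [Px|[A FA Ax]] [Py|[B FB By]].
  - by left; apply: Plin.
  - by apply: (up _ FB); [left|right].
  - by apply: (up _ FA); [right|left].
  - have [AB|BA] := Ftot _ _ FA FB.
    + by apply: (up _ FB); right; [exact: AB|].
    + by apply: (up _ FA); right; [|exact: BA].
have Z0 : ext A 0 by left.
have ZZ a x : ext A x -> ext A (a *: x).
  by move=> hx; rewrite -[_ *: _]addr0; apply: Alin.
have ZB x y : ext A x -> ext A y -> ext A (x - y).
  by move=> hx hy; rewrite addrC -scaleN1r; apply: Alin.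
have coord w : exists c, ext A (w - c *: v).
  have [hw|hw] := pselect (ext A w); first by exists 0; rewrite scale0r subr0.
  (* For [w] outside [ext A], the span of [w] and [ext A] is too large to be [ok], so it contains
     [v]; that relation can be solved for [w]. *)
  pose A' : set V := fun x => exists a z, ext A z /\ x = a *: w + z.
  have AA' : subset A A'.
    by move=> x Ax; exists 0, x; rewrite scale0r add0r; split=> //; right.
  have extA' x : ext A' x -> A' x.
    by case=> [Px|//]; exists 0, x; rewrite scale0r add0r; split=> //; left.
  have nok : ~ ok A'.
    move=> okA'; case: hw; right; apply: contrapT => nAw.
    apply: (Amax A') => //; split=> // A'A.
    by apply/nAw/A'A; exists 1, 0; rewrite scale1r addr0.
  suff [a [z [Zz vE]]] : A' v.
    have a0 : a != 0.
      by apply/eqP=> a0; apply: Av; rewrite vE a0 scale0r add0r.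
    exists a^-1; rewrite vE scalerDr scalerA mulVf // scale1r opprD addrA subrr.
    by rewrite sub0r -scalerN; apply: ZZ; rewrite -sub0r; apply: ZB.
  apply: contrapT => nv; apply: nok; split; last by move=> /extA'.
  move=> a x y /extA' [b [z [Zz ->]]] /extA' [c [t [Zt ->]]]; right.
  exists (a * b + c), (a *: z + t); split; first exact: Alin.
  by rewrite scalerDr scalerA scalerDl addrACA.
have [f fP] := choice coord.
(* Two different coefficients would put a nonzero multiple of [v] into [ext A]. This uniqueness
   gives the linearity and the values of [f]. *)
have funi w c : ext A (w - c *: v) -> f w = c.
  move=> hc; apply/eqP; rewrite -subr_eq0; apply: contrapT => /negP d0.
  apply: Av; have := ZZ (f w - c)^-1 _ (ZB _ _ hc (fP w)).
  have -> : w - c *: v - (w - f w *: v) = (f w - c) *: v.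
    by rewrite opprB [LHS]addrC addrA subrK scalerBl.
  by rewrite scalerA mulVf ?scale1r.
have [|g gE] := @linear_bundle _ V k^o f.
  move=> a x y; apply: funi; rewrite scalerDl -scalerA opprD addrACA -scalerBr.
  exact: Alin.
exists g; split=> [w Pw|]; rewrite gE; apply: funi.
  by rewrite scale0r subr0; left.
by rewrite scale1r subrr.
Qed.

(* A finite list [l] of pairs (e, c) of a vector and a functional is used as
   coordinates: they are valid at x when [coord_sum l x = x]. *)
Definition coord_sum (l : seq (V * {linear V -> k^o})) (x : V) : V :=
  \sum_(p <- l) p.2 x *: p.1.

Lemma coord_sum_linear l : linear (coord_sum l).
Proof.
move=> a x y; rewrite /coord_sum scaler_sumr -big_split /=.
by apply: eq_bigr => p _; rewrite linearP scalerDl scalerA.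
Qed.

(** The pair [(v, f)] is read off first and the old functionals are applied to the remainder, so
    vectors in the kernel of [f] keep their old coordinates. *)
Lemma coord_sum_extend l (v : V) (f : {linear V -> k^o}) :
  exists l', [/\ forall x, coord_sum l' x =
                    f x *: v + coord_sum l (x - f x *: v) &
                 forall p, p \in map fst l' -> p = v \/ p \in map fst l].
Proof.
have sub (g : {linear V -> k^o}) :
    exists g' : {linear V -> k^o}, forall x, g' x = g (x - f x *: v).
  apply: linear_bundle => a x y.
  rewrite -linearP [f (_ + _)]linearP scalerDl -scalerA opprD addrACA.
  by rewrite scalerBr.
have [s sE] := choice sub.
exists ((v, f) :: [seq (p.1, s p.2) | p <- l]); split.
  move=> x; rewrite /coord_sum big_cons big_map /=; congr (_ + _).
  by apply: eq_bigr => p _; rewrite sE.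
move=> p; rewrite /= inE -map_comp => /orP[/eqP->|]; [by left|by right].
Qed.

Lemma exists_coords (s : seq V) :
  exists l, {in s, forall x, coord_sum l x = x}.
Proof.
elim: s => [|y s [l lE]]; first by exists [::].
have [ly|/eqP ly] := pselect (coord_sum l y = y).
  by exists l => x; rewrite inE => /orP[/eqP->|/lE].
(* The vectors with valid coordinates form a subspace without [y]; a functional vanishing there and
   equal to 1 at [y] adds [y] and disturbs none of them. *)
pose P : {pred V} := fun x => coord_sum l x == x.
have [||f [fP fy]] := @exists_separating_functional P y.
- split=> [|a u v /eqP hu /eqP hv].
    by apply/eqP; rewrite /coord_sum big1 // => p _; rewrite raddf0 scale0r.
  by apply/eqP; rewrite coord_sum_linear hu hv.
- by [].
have [l' [l'E _]] := coord_sum_extend l y f.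
exists l' => x; rewrite l'E inE => /orP[/eqP->|xs].
  rewrite fy scale1r subrr [X in _ + X]big1 ?addr0 //.
  by move=> p _; rewrite raddf0 scale0r.
have -> : f x = 0 by apply: fP; apply/eqP; apply: lE.
by rewrite scale0r add0r subr0 lE.
Qed.

(** Induction on the list of functionals: the kernel of the first one in [P] has coordinates, and a
    single further vector accounts for the rest of [P]. *)
Lemma exists_coords_submod (I : eqType) (r : seq I)
    (f : I -> {linear V -> k^o}) (P : {pred V}) :
  submod_closed P ->
  {in P, forall x, {in r, forall i, f i x = 0} -> x = 0} ->
  exists l, {in P, forall x, coord_sum l x = x} /\
            {subset map fst l <= P}.
Proof.
elim: r P => [|i r IH] P cP sep.
  by exists [::]; split=> // x Px; rewrite /coord_sum big_nil (sep x).
have [P0 Plin] := cP.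
pose Q : {pred V} := fun x => (x \in P) && (f i x == 0).
have [||l [lE lP]] := IH Q.
- split=> [|a u v /andP[Pu /eqP fu] /andP[Pv /eqP fv]]; apply/andP; split=> //.
  + by rewrite raddf0.
  + exact: Plin.
  + by rewrite linearP fu fv addr0 scaler0.
- move=> x /andP[Px /eqP fx] h; apply: sep => // j.
  by rewrite inE => /orP[/eqP->|/h].
have [[v [Pv fv]]|nv] := pselect (exists v, v \in P /\ f i v = 1); last first.
  (* Here [f i] vanishes on [P], so [Q] is already all of [P]. *)
  exists l; split=> [x Px|p /lP /andP[] //]; apply: lE; apply/andP; split=> //.
  apply: contrapT => /negP fx; apply: nv; exists ((f i x)^-1 *: x); split.
    by rewrite -[_ *: _]addr0; exact: Plin.
  by rewrite linearZ /= [_ *: _]mulVf.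
have [l' [l'E l'P]] := coord_sum_extend l v (f i).
exists l'; split=> [x Px|p /l'P[->|/lP/andP[]] //].
rewrite l'E lE; first by rewrite addrC subrK.
apply/andP; split; first by rewrite addrC -scaleNr; exact: Plin.
have -> : f i (x - f i x *: v) = f i x - f i x * f i v.
  by rewrite linearB linearZ.
by rewrite fv mulr1 subrr.
Qed.

End LinearAlgebra.

(** * Maps out of tensor products and their linearity *)

Section TensorLift.

Variables (R : Type) (M N : zmodType) (ra : M -> R -> M) (la : R -> N -> N).
Implicit Type t : tensor ra la.

(** [tlift] evaluates a chosen representative in the free abelian group, so for any [F] it is a
    finite integer combination of values; the rules below become identities of finite sums. *)
Lemma tlift_sum (V : zmodType) (F : M -> N -> V) t :
  tlift F t = \sum_(z <- dom (repr t)) F z.1 z.2 *~ coeff z (repr t).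
Proof.
 pose f (p : M * N) : zmodule V := F p.1 p.2.
have fB : zmod_morphism (fglift f) by exact: lift_is_additive.
pose m := GRing.isZmodMorphism.Build _ _ (fglift f) fB.
pose g := HB.pack (fglift f) m : {additive _ -> zmodule V}.
rewrite -[LHS]/(g (repr t)) -{1}[repr t]freeg_sumE raddf_sum.
by apply: eq_bigr => z _; rewrite /g /= liftU.
Qed.

Lemma eq_tlift (V : zmodType) (F G : M -> N -> V) t :
  (forall x y, F x y = G x y) -> tlift F t = tlift G t.
Proof. by move=> FG; rewrite !tlift_sum; apply: eq_bigr => z _; rewrite FG. Qed.

Lemma morph_tlift (V W : zmodType) (g : V -> W) (F : M -> N -> V) t :
  {morph g : x y / x + y} -> g (tlift F t) = tlift (fun x y => g (F x y)) t.
Proof.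
move=> gD; have gB : zmod_morphism g.
  move=> x y; apply: (addIr (g y)); rewrite -gD subrK addrNK //.
pose f : {additive V -> W} := HB.pack g (GRing.isZmodMorphism.Build _ _ g gB).
rewrite -[g]/(f : V -> W) !tlift_sum raddf_sum.
by apply: eq_bigr => z _; rewrite raddfMz.
Qed.

Lemma tlift_sumr (V : zmodType) (I : Type) (r : seq I)
    (F : I -> M -> N -> V) t :
  tlift (fun x y => \sum_(i <- r) F i x y) t = \sum_(i <- r) tlift (F i) t.
Proof.
under [RHS]eq_bigr do rewrite tlift_sum.
by rewrite tlift_sum exchange_big; apply: eq_bigr => z _; rewrite mulrz_suml.
Qed.

Lemma linear_tlift_fun (k : pzRingType) (U V : lmodType k)
    (F : U -> M -> N -> V) t :
  (forall x y, linear (fun u => F u x y)) -> linear (fun u => tlift (F u) t).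
Proof.
move=> FL a u v; rewrite !tlift_sum scaler_sumr -big_split /=.
by apply: eq_bigr => z _; rewrite FL mulrzDl scalerMzr.
Qed.

End TensorLift.

Lemma exchange_tlift (R R' : Type) (M N M' N' V : zmodType)
    (ra : M -> R -> M) (la : R -> N -> N) (ra' : M' -> R' -> M')
    (la' : R' -> N' -> N') (F : M -> N -> M' -> N' -> V)
    (s : tensor ra la) (t : tensor ra' la') :
  tlift (fun x y => tlift (F x y) t) s =
  tlift (fun x' y' => tlift (fun x y => F x y x' y') s) t.
Proof.
rewrite [LHS]tlift_sum [RHS]tlift_sum.
under eq_bigr do rewrite tlift_sum mulrz_suml.
under [RHS]eq_bigr do rewrite tlift_sum mulrz_suml.
rewrite exchange_big; apply: eq_bigr => z _; apply: eq_bigr => w _.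
by rewrite mulrzAC.
Qed.

Section Linearity.

Variables (k : comNzRingType) (U V W : lmodType k).

Lemma linear_funD (f : U -> V) : linear f -> {morph f : x y / x + y}.
Proof. by move=> fL x y; rewrite -[x]scale1r fL !scale1r. Qed.

Lemma linear_funZ (f : U -> V) c x : linear f -> f (c *: x) = c *: f x.
Proof.
move=> fL; have f0 : f 0 = 0.
  by apply: (addrI (f 0)); rewrite -(linear_funD fL) !addr0.
by rewrite -[c *: x]addr0 fL f0 addr0.
Qed.

Lemma linear_fun_id : linear (fun x : U => x).
Proof. by []. Qed.

Lemma linear_fun_bundled (f : {linear V -> W}) (g : U -> V) :
  linear g -> linear (fun x => f (g x)).
Proof. by move=> gL a x y; rewrite gL linearP. Qed.

Lemma linear_fun_compose (f : V -> W) (g : U -> V) :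
  linear f -> linear g -> linear (fun x => f (g x)).
Proof. by move=> fL gL a x y; rewrite gL fL. Qed.

Lemma linear_fun_scale (c : k) (g : U -> V) :
  linear g -> linear (fun x => c *: g x).
Proof. by move=> gL a x y; rewrite gL scalerDr !scalerA mulrC. Qed.

Lemma linear_fun_scalel (c : U -> k^o) (w : V) :
  linear c -> linear (fun x => c x *: w).
Proof. by move=> cL a x y; rewrite cL scalerDl scalerA. Qed.

Lemma linear_fun_mull (A : algType k) (g : U -> A) (c : A) :
  linear g -> linear (fun x => c * g x).
Proof. by move=> gL a x y; rewrite gL mulrDr scalerAr. Qed.

Lemma linear_fun_mulr (A : algType k) (g : U -> A) (c : A) :
  linear g -> linear (fun x => g x * c).
Proof. by move=> gL a x y; rewrite gL mulrDl scalerAl. Qed.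

Lemma linear_fun_sum (I : Type) (r : seq I) (F : I -> U -> V) :
  (forall i, linear (F i)) -> linear (fun x => \sum_(i <- r) F i x).
Proof.
move=> FL a x y; rewrite scaler_sumr -big_split /=.
by apply: eq_bigr => i _; rewrite FL.
Qed.

End Linearity.

Section BilinearLift.

Variables (k : comNzRingType) (M N U V : lmodType k).

Definition bilin (F : M -> N -> V) :=
  (forall y, linear (F^~ y)) /\ (forall x, linear (F x)).

Lemma bilin_tlift_balanced (F : M -> N -> V) : bilin F -> bilin_balanced F.
Proof.
case=> Fl Fr; split=> [y|x|x c y]; [|exact: linear_funD|].
  exact: (linear_funD (Fl y)).
by rewrite [RHS](linear_funZ _ _ (Fr x)) -[LHS]/((F^~ y) _) linear_funZ.
Qed.

Lemma linear_fun_tlift (F : M -> N -> V) (g : U -> tens M N) :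
  bilin F -> linear g -> linear (fun x => tlift F (g x)).
Proof.
move=> FL gL a x y; have Fb := bilin_tlift_balanced FL; rewrite gL tliftD //.
congr (_ + _); case: FL => Fl _; elim/tensor_ind: (g x) => [|s t hs ht|u v].
- by rewrite scaler0 tlift0 // scaler0.
- by rewrite scalerDr !tliftD // hs ht scalerDr.
- rewrite [_ *: _]tens_scale_pure !tlift_pure //.
  exact: (linear_funZ _ _ (Fl v)).
Qed.

End BilinearLift.

(* Sweedler notation: the sum of E over a (x) b = h_(1) (x) h_(2). *)
Local Notation "\sw_ ( a , b <- h ) E" :=
  (tlift (fun a b => E) (comul h))
  (at level 41, a name, b name, h at level 35, E at level 41,
   right associativity,
   format "'[' \sw_ ( a ,  b  <-  h ) '/  '  E ']'").

(** Follows the single occurrence of the bound variable through products, scalings, sums, bundled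
    maps and [tlift], in the body or in the tensor argument. *)
Ltac linearity := solve [
  intros; repeat first
    [ match goal with |- bilin _ => split; intros; cbn beta end
    | exact: linear_fun_id
    | solve [auto]
    | match goal with |- GRing.linear_for _ (GRing.Linear.sort _) =>
        exact: linearP end
    | match goal with |- GRing.linear_for _ (GRing.mul ?c) =>
        apply: linear_fun_mull; exact: linear_fun_id end
    | match goal with |- GRing.linear_for _ (GRing.scale ?c) =>
        apply: linear_fun_scale; exact: linear_fun_id end
    | match goal with |- GRing.linear_for _ (tlift ?F) =>
        apply: (@linear_fun_tlift _ _ _ _ _ F id) end
    | match goal with |- GRing.linear_for _ (fun x => GRing.mul ?c _) =>
        apply: linear_fun_mull end
    | match goal with |- GRing.linear_for _ (fun x => GRing.mul _ ?c) =>
        apply: linear_fun_mulr end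
    | match goal with |- GRing.linear_for _ (fun x => GRing.scale ?c _) =>
        apply: linear_fun_scale end
    | match goal with |- GRing.linear_for _ (fun x => GRing.scale _ ?c) =>
        apply: linear_fun_scalel end
    | match goal with |- GRing.linear_for _ (fun x => tlift _ ?t) =>
        apply: linear_tlift_fun => ? ? end
    | match goal with |- GRing.linear_for _ (fun x => tlift ?F _) =>
        apply: linear_fun_tlift end
    | match goal with |- GRing.linear_for _ (fun x => \sum_(i <- ?r) _) =>
        apply: linear_fun_sum => ? end
    | match goal with |- GRing.linear_for _ (fun x => GRing.Linear.sort ?f _) =>
        apply: linear_fun_bundled end
    | match goal with FL : forall y, GRing.linear_for _ (fun x => ?F x y)
        |- GRing.linear_for _ (fun x => ?F _ ?c) =>
        apply: (linear_fun_compose (FL c)) end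
    | match goal with FL : forall x, GRing.linear_for _ (?F x)
        |- GRing.linear_for _ (fun x => ?F ?c _) =>
        apply: (linear_fun_compose (FL c)) end ]].

(** * Hopf algebra identities in Sweedler notation *)

Section HopfCalculus.

Variables (k : fieldType) (H : hopfAlgType k).
Implicit Types (V W : lmodType k) (h : H).

Lemma sw_counitl V (G : H -> V) h :
  linear G -> \sw_(a, b <- h) counit a *: G b = G h.
Proof.
move=> GL; rewrite -{2}[h]counitl (morph_tlift _ _ (linear_funD GL)).
by apply: eq_tlift => a b; rewrite linear_funZ.
Qed.

Lemma sw_counitr V (G : H -> V) h :
  linear G -> \sw_(a, b <- h) counit b *: G a = G h.
Proof.
move=> GL; rewrite -{2}[h]counitr (morph_tlift _ _ (linear_funD GL)).
by apply: eq_tlift => a b; rewrite linear_funZ.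
Qed.

Lemma sw_antipodel V (G : H -> V) h :
  linear G -> \sw_(a, b <- h) G (antipode a * b) = counit h *: G 1.
Proof.
move=> GL; rewrite -linear_funZ // -antipodel.
by rewrite (morph_tlift _ _ (linear_funD GL)).
Qed.

Lemma sw_antipoder V (G : H -> V) h :
  linear G -> \sw_(a, b <- h) G (a * antipode b) = counit h *: G 1.
Proof.
move=> GL; rewrite -linear_funZ // -antipoder.
by rewrite (morph_tlift _ _ (linear_funD GL)).
Qed.

Lemma sw_mul V (F : H -> H -> V) x y : bilin F ->
  \sw_(a, b <- x * y) F a b =
  \sw_(a, b <- x) \sw_(c, d <- y) F (a * c) (b * d).
Proof.
move=> FL; have Fb := bilin_tlift_balanced FL; have FD := tliftD Fb.
have [_ ->] := comul_monoid_morphism (s := H).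
rewrite [_ * _]/(tens_mul _ _) (morph_tlift _ _ FD); apply: eq_tlift => a b.
by rewrite (morph_tlift _ _ FD); apply: eq_tlift => c d; rewrite tlift_pure.
Qed.

Lemma sw_coassoc V (F : H -> H -> H -> V) h :
  (forall b c, linear (fun a => F a b c)) ->
  (forall a c, linear (fun b => F a b c)) ->
  (forall a b, linear (fun c => F a b c)) ->
  \sw_(a, c <- h) \sw_(a1, a2 <- a) F a1 a2 c =
  \sw_(a, b <- h) \sw_(b1, b2 <- b) F a b1 b2.
Proof.
move=> F1 F2 F3.
have Fb a : bilin (F a) by [].
(* [T] is the map on triple tensors induced by [F]; it is applied to both sides of [coassoc]. *)
pose T : tens H (tens H H) -> V := tlift (fun a s => tlift (F a) s).
have TL : bilin (fun a (s : tens H H) => tlift (F a) s).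
  by linearity.
have TD : {morph T : x y / x + y} := tliftD (bilin_tlift_balanced TL).
have tD : {morph (@tassoc _ H H H) : x y / x + y}.
  by apply: tliftD; exact: tassoc_balanced.
have TE a s : T (tpure a s) = tlift (F a) s.
  exact: (tlift_pure _ _ (bilin_tlift_balanced TL)).
have := congr1 T (coassoc h).
rewrite /tmap (morph_tlift _ _ tD) !(morph_tlift _ _ TD) => E.
transitivity (tlift (fun x y => T (tassoc (tpure (comul x) (idfun y))))
    (comul h)).
  apply: eq_tlift => a c.
  rewrite /tassoc tlift_pure; last exact: tassoc_balanced.
  rewrite (morph_tlift _ _ TD); apply: eq_tlift => x y.
  by rewrite TE (tlift_pure _ _ (bilin_tlift_balanced (Fb x))).
by rewrite E; apply: eq_tlift => a b; rewrite TE.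
Qed.

Lemma counitM (x y : H) : counit (x * y) = counit x * counit y.
Proof. by have [_ ->] := counit_monoid_morphism (s := H). Qed.

Lemma counit1 : counit (1 : H) = 1.
Proof. by have [] := counit_monoid_morphism (s := H). Qed.

(** Inserting S(h_1) h_2 in front gives S(h_1) h_2 b_1 S(h_3 b_2). All but the first factor form x_1
    S(x_2) for x = h_2 b, which collapses to the counit. *)
Lemma sw_mul_antipode h b :
  \sw_(u, v <- b) u * antipode (h * v) = counit b *: antipode h.
Proof.
pose F (h1 h2 h3 : H) :=
  \sw_(u, v <- b) antipode h1 * (h2 * u * antipode (h3 * v)).
transitivity (\sw_(h1, h' <- h) \sw_(h2, h3 <- h') F h1 h2 h3).
  rewrite -sw_coassoc; rewrite /F; try linearity.
  transitivity (\sw_(a, c <- h)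
      counit a *: \sw_(u, v <- b) u * antipode (c * v)).
    rewrite (sw_counitl
      (G := fun c => \sw_(u, v <- b) u * antipode (c * v))) //.
    by linearity.
  apply: eq_tlift => a c; rewrite /F exchange_tlift.
  rewrite (morph_tlift _ _ (scalerDr _)); apply: eq_tlift => u v.
  rewrite -{1}[u]mul1r -[_ * u * _]mulrA.
  rewrite -(sw_antipodel (G := fun x => x * (u * antipode (c * v)))) //.
    by apply: eq_tlift => x y; rewrite !mulrA.
  by linearity.
transitivity (\sw_(h1, h' <- h) counit h' *: (counit b *: antipode h1)).
  apply: eq_tlift => h1 h'; rewrite scalerA -counitM -[antipode h1]mulr1.
  rewrite -(sw_antipoder (G := fun x => antipode h1 * x)); last by linearity.
  by rewrite sw_mul //; linearity.
by rewrite (sw_counitr (G := fun h => counit b *: antipode h)) //; linearity.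
Qed.

(** S(h b) = S(b_1) b_2 S(h b_3), and [sw_mul_antipode] turns b_2 S(h b_3) into a counit times
    S(h). *)
Lemma antipodeM (h b : H) : antipode (h * b) = antipode b * antipode h.
Proof.
transitivity (\sw_(b1, b' <- b) counit b' *: (antipode b1 * antipode h));
  last first.
  by rewrite (sw_counitr (G := fun b => antipode b * antipode h)) //; linearity.
transitivity (\sw_(b1, b' <- b) \sw_(u, v <- b')
    antipode b1 * u * antipode (h * v)).
  rewrite -(sw_coassoc (F := fun b1 u v =>
    antipode b1 * u * antipode (h * v))); try linearity.
  rewrite -[LHS](sw_counitl (G := fun v => antipode (h * v)));
    last by linearity.
  apply: eq_tlift => a c; rewrite -{1}[antipode (h * c)]mul1r.
  by rewrite -(sw_antipodel (G := fun x => x * antipode (h * c))) //; linearity.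
apply: eq_tlift => b1 b'; rewrite scalerAr -sw_mul_antipode.
rewrite (morph_tlift _ _ (mulrDr _)); apply: eq_tlift => u v.
by rewrite mulrA.
Qed.

Lemma antipode1 : antipode (1 : H) = 1.
Proof.
have := antipodel (1 : H); have [-> _] := comul_monoid_morphism (s := H).
rewrite counit1 scale1r [X in tlift _ X]/(tpure 1 1).
have L : bilin (fun a b : H => antipode a * b) by linearity.
by rewrite (tlift_pure _ _ (bilin_tlift_balanced L)) mulr1.
Qed.

End HopfCalculus.

(** * Integrals and finite dimensionality *)

Section Integral.

Variables (k : fieldType) (H : hopfAlgType k).

Lemma tens_seq (M N : lmodType k) (t : tens M N) :
  exists s : seq (M * N), t = \sum_(p <- s) tpure p.1 p.2.
Proof.
elim/tensor_ind: t => [|t u [s ->] [r ->]|x y].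
- by exists [::]; rewrite big_nil.
- by exists (s ++ r); rewrite big_cat.
- by exists [:: (x, y)]; rewrite big_seq1.
Qed.

Lemma tlift_seq (M N V : lmodType k) (F : M -> N -> V) (s : seq (M * N)) :
  bilin F ->
  tlift F (\sum_(p <- s) tpure p.1 p.2) = \sum_(p <- s) F p.1 p.2.
Proof.
move=> /bilin_tlift_balanced Fb.
elim: s => [|p s IH]; first by rewrite !big_nil tlift0.
by rewrite !big_cons tliftD // IH tlift_pure.
Qed.

(** The kernel of the counit is a left ideal. The component [q] of 1 in a complement [J] is the
    integral, since h q - eps(h) q lies both in [J] and in that kernel. *)
Lemma semisimple_integral : semisimple H ->
  exists L : H, (forall h, h * L = counit h *: L) /\ counit L = 1.
Proof.
move=> ss; pose I : {pred H^o} := fun h => counit (h : H) == 0.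
have IE h : (h \in I) = (counit (h : H) == 0) by [].
have [|J [[J0 Jlin] [IJ0 IJ]]] := ss I.
  split=> [|a x y]; rewrite !IE ?raddf0 // raddfD /= => /eqP hx /eqP hy.
  by rewrite [_ *: _]/(a * x) counitM hx hy mulr0 addr0.
have [p [q [pI qJ E]]] := IJ 1.
have cq : counit (q : H) = 1.
  have := counit1 H; rewrite [X in counit X]E raddfD /=.
  by rewrite IE in pI; rewrite (eqP pI) add0r.
exists q; split=> // h; apply/eqP; rewrite -subr_eq0; apply/eqP/IJ0.
  have cx (x : H) : counit (h * x - counit h *: x) =
      counit h * counit x - counit h * counit x.
    by rewrite linearB /= counitM [in LHS]linearZ.
  by rewrite IE cx subrr.
have -> : h * (q : H) - counit h *: (q : H) = (h - (counit h)%:A) * (q : H).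
  by rewrite mulrBl -scalerAl mul1r.
by rewrite -[_ * _]addr0; apply: (Jlin (h - (counit h)%:A) q 0).
Qed.

(** The Casimir property of L_1 (x) S(L_2). Inserting S(a_2) a_3 gives a_1 L_1 (x) S(a_2 L_2) a_3,
    where a_1 L_1 (x) a_2 L_2 is the coproduct of a_1 L = eps(a_1) L. *)
Lemma sw_integral (V : lmodType k) (L a : H) (F : H -> H -> V) :
  (forall h, h * L = counit h *: L) -> bilin F ->
  \sw_(u, v <- L) F (a * u) (antipode v) =
  \sw_(u, v <- L) F u (antipode v * a).
Proof.
move=> LL [F1 F2].
transitivity (\sw_(a1, a' <- a) \sw_(a2, a3 <- a') \sw_(u, v <- L)
    F (a1 * u) (antipode (a2 * v) * a3)).
  rewrite -[LHS](sw_counitr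
    (G := fun a => \sw_(u, v <- L) F (a * u) (antipode v))).
    apply: eq_tlift => a1 a'; rewrite exchange_tlift.
    rewrite (morph_tlift _ _ (scalerDr _)); apply: eq_tlift => u v.
    rewrite -{1}[antipode v]mulr1.
    rewrite -(sw_antipodel (G := fun x => F (a1 * u) (antipode v * x))).
      by apply: eq_tlift => x y; rewrite antipodeM mulrA.
    by linearity.
  by linearity.
rewrite -(sw_coassoc (F := fun a1 a2 a3 =>
  \sw_(u, v <- L) F (a1 * u) (antipode (a2 * v) * a3))); try linearity.
rewrite -[RHS](sw_counitl (G := fun a => \sw_(u, v <- L) F u (antipode v * a)));
  last by linearity.
apply: eq_tlift => a' a3.
rewrite -(@linear_funZ _ _ _ (fun x => \sw_(u, v <- x) F u (antipode v * a3)));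
  last by linearity.
by rewrite -LL sw_mul //; linearity.
Qed.

(** In a = a L_1 S(L_2), expand S(L_2) in coordinates (e_j, c_j) and move [a] across by
    [sw_integral]: a is the sum of c_j(S(L_2) a) L_1 e_j. So the finitely many functionals a |->
    c_j(S(L_2) a) separate points. *)
Lemma coords_submod (P : {pred H}) : semisimple H -> submod_closed P ->
  exists l : seq (H * {linear H -> k^o}),
    {in P, forall x, coord_sum l x = x} /\ {subset map fst l <= P}.
Proof.
move=> /semisimple_integral[L [LL L1]] PP.
have [s sE] := tens_seq (comul L).
have [l lE] := exists_coords [seq antipode p.2 | p <- s].
(* The zero functional only provides a default entry [d] for [nth]; the indices used stay below
   [size l]. *)
have zL : linear (fun _ : H => 0 : k^o).
  by move=> a x y; rewrite addr0 [RHS]mulr0.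
have [z _] := linear_bundle zL; pose d : H * {linear H -> k^o} := (0, z).
have fE (i : (H * H) * nat) : exists f : {linear H -> k^o},
    f =1 fun a => (nth d l i.2).2 (antipode i.1.2 * a).
  by apply: linear_bundle; linearity.
have [f fP] := choice fE.
apply: (@exists_coords_submod _ _ _
  [seq (p, j) | p <- s, j <- iota 0 (size l)] f) => // a _ fa.
have -> : a = \sum_(q <- l) (\sw_(u, v <- L) q.2 (antipode v) *: (a * u)) * q.1.
  transitivity (\sw_(u, v <- L) (a * (u * antipode v))).
    rewrite (sw_antipoder (G := fun x => a * x)) ?L1 ?scale1r ?mulr1 //.
    by linearity.
  rewrite sE; transitivity (\sum_(p <- s) \sum_(q <- l)
      (q.2 (antipode p.2) *: (a * p.1)) * q.1).
    rewrite tlift_seq; last by linearity.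
    apply: eq_big_seq => p ps.
    rewrite mulrA -{1}[antipode p.2]lE; last by apply/mapP; exists p.
    by rewrite mulr_sumr; apply: eq_bigr => q _; rewrite -scalerAl -scalerAr.
  rewrite exchange_big; apply: eq_bigr => q _ /=.
  by rewrite tlift_seq ?mulr_suml //; linearity.
rewrite (big_nth d) big_nat big1 // => j /andP[_ jl].
rewrite (@sw_integral H L a (fun u v : H => ((nth d l j).2 v : k) *: u)) //;
  last by linearity.
rewrite sE tlift_seq; last by linearity.
rewrite big1_seq ?mul0r // => p /= ps.
have := fa (p, j); rewrite fP /= => ->; first by rewrite scale0r.
by apply/allpairsP; exists (p, j); rewrite mem_iota.
Qed.

End Integral.

(** * Depth two: splitting the tensor square and transferring invariance *)

Section DepthTwoSplit.

Variables (A : nzRingType) (B : {pred A}).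

(* t i is the image of the i-th standard basis vector under the splitting
   A^n -> A (x)_B A of f. *)
Lemma left_depth_two_split : left_depth_two B ->
  exists (n : nat) (t : 'I_n -> tensor_over B)
         (f : tensor_over B -> {ffun 'I_n -> A}),
    (forall b x, b \in B -> f (tensor_over_lact b x) = power_lact b (f x)) /\
    (forall x, x = \sum_i tensor_over_ract (t i) (f x i)).
Proof.
case=> n _ [P [Q [[[P0 PB] _ PR] [[Q0 QB] _ QR] [PQ0 PQ]
  [f [[fD fL fR] finj fP]]]]].
pose N := power_bimodule A n.
have PS (I : finType) (F : I -> N) :
    (forall i, F i \in P) -> \sum_i F i \in P.
  move=> FP; apply: (big_ind (fun x => x \in P)) => // x y xP yP.
  by rewrite -[y]opprK; apply: (PB) => //; rewrite -sub0r; apply: (PB).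
have QS (I : finType) (F : I -> N) :
    (forall i, F i \in Q) -> \sum_i F i \in Q.
  move=> FQ; apply: (big_ind (fun x => x \in Q)) => // x y xQ yQ.
  by rewrite -[y]opprK; apply: (QB) => //; rewrite -sub0r; apply: (QB).
pose e (i : 'I_n) : N := [ffun j => (j == i)%:R].
have eE (v : N) : v = \sum_i ract (e i) (v i).
  apply/ffunP=> j; rewrite sum_ffunE (bigD1 j) //= !ffunE eqxx mul1r.
  by rewrite big1 ?addr0 // => i ij; rewrite !ffunE eq_sym (negPf ij) mul0r.
have tP i : exists t, e i - f t \in Q.
  have [p [q [pP qQ ->]]] := PQ (e i); have [t pt] := (fP p).1 pP.
  by exists t; rewrite -pt addrC addKr.
have [t tE] := choice tP.
have f0 : f 0 = 0 by apply: (addrI (f 0)); rewrite -fD !addr0.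
exists n, t, f; split=> [b x bB|x]; first exact: fL.
have fR' y a : f (tensor_over_ract y a) = ract (f y : N) a by exact: fR.
have fsum (F : 'I_n -> tensor_over B) : f (\sum_i F i) = \sum_i f (F i).
  exact: (big_morph f fD f0).
(* The difference of the images lies in [P]; being the sum of the (e_i - f(t_i)) f(x)_i it also lies
   in [Q], so it vanishes. *)
apply: finj; apply/eqP; rewrite -subr_eq0; apply/eqP/PQ0.
  by apply: PB; apply/fP; eexists.
rewrite [X in X - _]eE fsum -sumrB; apply: QS => i.
have -> : f (tensor_over_ract (t i) (f x i)) = ract (f (t i) : N) (f x i) by [].
have -> : ract (e i) (f x i) - ract (f (t i) : N) (f x i) =
    ract (e i - f (t i) : N) (f x i).
  by apply/ffunP=> j; rewrite !ffunE mulrBl.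
exact: QR.
Qed.

End DepthTwoSplit.

Section DepthTwoHopf.

Variables (k : fieldType) (H : hopfAlgType k) (K : {pred H}).

(** The right invariance of [G] makes [phi] well defined, and [phi] turns right multiplication into
    the counit. The splitting thus expresses [phi x] through the counits of the coordinates [f x i],
    and left [K]-linearity of [f] multiplies these by eps(b). *)
Lemma left_depth_two_invariant (V : lmodType k) (G : H -> V) :
  left_depth_two K -> linear G ->
  (forall u b, b \in K -> G (u * b) = counit b *: G u) ->
  forall b u, b \in K -> G (b * u) = counit b *: G u.
Proof.
move=> /left_depth_two_split[n [t [f [fL fE]]]] GL GK b u bK.
have GD := linear_funD GL.
pose phi : tensor_over K -> V := tlift (fun x y => counit y *: G x).
have phib : balanced (fun (x : H) (b : {b : H | b \in K}) => x * val b)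
    (fun (b : {b : H | b \in K}) (y : H) => val b * y)
    (fun x y => counit y *: G x).
  split=> [y x x'|x y y'|x [c cK] y] /=.
  - by rewrite GD scalerDr.
  - by rewrite raddfD scalerDl.
  - by rewrite GK // scalerA counitM mulrC.
have phiD : {morph phi : x y / x + y} := tliftD phib.
have phi0 : phi 0 = 0 := tlift0 phib.
have phiR x a : phi (tensor_over_ract x a) = counit a *: phi x.
  elim/tensor_ind: x => [|x y hx hy|x y].
  - by rewrite tensor_over_ract0 phi0 scaler0.
  - by rewrite tensor_over_ractD !phiD hx hy scalerDr.
  - by rewrite tensor_over_ract_pure /phi !tlift_pure // counitM scalerA mulrC.
have phiE x : phi x = \sum_i counit (f x i) *: phi (t i).
  rewrite {1}[x]fE (big_morph phi phiD phi0).
  by apply: eq_bigr => i _; rewrite phiR.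
have GE x : G x = phi (tensor_over_pure x 1).
  by rewrite /phi tlift_pure // counit1 scale1r.
rewrite !GE -tensor_over_lact_pure !phiE scaler_sumr; apply: eq_bigr => i _.
by rewrite fL // ffunE counitM scalerA.
Qed.

End DepthTwoHopf.

(** * A right linear retraction onto a Hopf subalgebra *)

Section HopfSubalgebra.

Variables (k : fieldType) (H : hopfAlgType k) (K : {pred H}).
Hypothesis hK : hopf_subalgebra K.

Let K_lin a x y : x \in K -> y \in K -> a *: x + y \in K.
Proof. by case: hK => -[_ lin _] _ _; exact: lin. Qed.

Let K_mul x y : x \in K -> y \in K -> x * y \in K.
Proof. by case: hK => -[_ _ mul] _ _; exact: mul. Qed.

Let K_one : 1 \in K. Proof. by case: hK => -[]. Qed.

Let K_antipode x : x \in K -> antipode x \in K.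
Proof. by case: hK => _ _; apply. Qed.

Lemma hopf_subalgebra_submod : submod_closed K.
Proof.
split=> [|a x y]; last exact: K_lin.
by rewrite -(addNr (1 : H)) -scaleN1r; apply: K_lin.
Qed.

Let K_sum (I : Type) (r : seq I) (F : I -> H) :
  (forall i, F i \in K) -> \sum_(i <- r) F i \in K.
Proof.
move=> FK; have [K0 _] := hopf_subalgebra_submod.
apply: (big_ind (fun x => x \in K)) => // x y xK yK.
by rewrite -[x]scale1r; apply: K_lin.
Qed.

Lemma sw_subalgebra_eq (V : lmodType k) (F G : H -> H -> V) x :
  x \in K -> bilin F -> bilin G ->
  (forall u v, u \in K -> v \in K -> F u v = G u v) ->
  \sw_(u, v <- x) F u v = \sw_(u, v <- x) G u v.
Proof.
case: hK => _ comulK _ /comulK[s [/allP sK ->]] Fb Gb FG.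
rewrite !tlift_seq //; apply: eq_big_seq => p ps.
by have /andP[] := sK p ps; exact: FG.
Qed.

Lemma sw_subalgebra_mem (F : H -> H -> H) x :
  x \in K -> bilin F -> (forall u v, u \in K -> v \in K -> F u v \in K) ->
  \sw_(u, v <- x) F u v \in K.
Proof.
case: hK => _ comulK _ /comulK[s [sK ->]] Fb FK; rewrite tlift_seq //.
have [K0 _] := hopf_subalgebra_submod.
elim: s sK => [|p s IH]; first by rewrite big_nil.
rewrite big_cons /= => /andP[/andP[p1 p2] sK].
by rewrite -[F _ _]scale1r; apply: K_lin; [exact: FK|exact: IH].
Qed.

Section Retraction.

Variables (m : nat) (e : 'I_m -> H) (c : 'I_m -> {linear H -> k^o}).
Variable r : {linear H -> H}.
Hypotheses (eK : forall i, e i \in K)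
  (cE : {in K, forall x, x = \sum_i (c i x : k) *: e i}).
Hypotheses (rK : forall x, r x \in K) (rE : {in K, forall x, r x = x}).

(* The trace over K of x |-> S(g(x)_1) (x) g(x)_2 is taken in the coordinates
   (e, c); theta carries an extra factor s through which elements of K are
   moved cyclically in theta_trace. *)
Let g h x := \sw_(u, v <- x) r (h * u) * antipode v.
Let theta s i y : H := \sw_(u, v <- y) (c i (s * antipode u) : k) *: v.

Definition trace_retraction h := \sum_i theta 1 i (g h (e i)).

Let g_mem h x : x \in K -> g h x \in K.
Proof.
move=> xK; apply: sw_subalgebra_mem => //; first by linearity.
by move=> u v _ vK; apply: K_mul => //; exact: K_antipode.
Qed.

(** Since S(b_2 x_2) b_3 = S(x_2) S(b_2) b_3, the extra factors on the right cancel to a counit. *)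
Let g_mul h b x : g (h * b) x = \sw_(b1, b2 <- b) g h (b1 * x) * b2.
Proof.
pose F u v w := \sw_(x1, x2 <- x) r (h * (u * x1)) * antipode (v * x2) * w.
transitivity (\sw_(a, b2 <- b) \sw_(u, v <- a) F u v b2); last first.
  apply: eq_tlift => a b2; rewrite /g sw_mul; last by linearity.
  rewrite (morph_tlift _ _ (fun x y => mulrDl x y b2)); apply: eq_tlift => u v.
  by rewrite (morph_tlift _ _ (fun x y => mulrDl x y b2)).
rewrite /F sw_coassoc; try linearity.
transitivity (\sw_(u, b' <- b) counit b' *: g (h * u) x).
  by rewrite (sw_counitr (G := fun u => g (h * u) x)) // /g; linearity.
apply: eq_tlift => u b'; rewrite exchange_tlift.
rewrite (morph_tlift _ _ (scalerDr _)); apply: eq_tlift => x1 x2.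
rewrite -[antipode x2]mulr1 mulrA.
rewrite -(sw_antipodel (G := fun y => r (h * u * x1) * antipode x2 * y));
  last by linearity.
by apply: eq_tlift => v w; rewrite antipodeM !mulrA.
Qed.

(** Cyclicity of the trace: the matrix c_j(a e_i) of left multiplication by [a] is carried to the
    other end, where it acts on the expansion of s S(u) in the e_i. *)
Let theta_trace h a s : a \in K -> s \in K ->
  \sum_i theta s i (g h (a * e i)) = \sum_i theta (a * s) i (g h (e i)).
Proof.
move=> aK sK.
transitivity (\sum_i \sum_j (c j (a * e i) : k) *: theta s i (g h (e j))).
  apply: eq_bigr => i _; rewrite {1}(cE (K_mul aK (eK i))).
  have L : linear (fun y => theta s i (g h y)) by rewrite /theta /g; linearity.
  have [f fE] := linear_bundle L.
  rewrite -[LHS]fE linear_sum; apply: eq_bigr => j _.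
  by rewrite linearZ /= fE.
rewrite exchange_big; apply: eq_bigr => j _ /=.
under eq_bigr do rewrite /theta (morph_tlift _ _ (scalerDr _)).
rewrite -tlift_sumr.
apply: sw_subalgebra_eq; [exact: g_mem|linearity|linearity|].
move=> u v uK vK; have suK := K_mul sK (K_antipode uK).
rewrite -mulrA {2}(cE suK) mulr_sumr linear_sum scaler_suml.
apply: eq_bigr => i _; rewrite scalerA -scalerAr linearZ /=.
by congr (_ *: _); rewrite [RHS]mulrC.
Qed.

Let theta_mul i y b :
  theta 1 i (y * b) = \sw_(b1, b2 <- b) theta (antipode b1) i y * b2.
Proof.
rewrite /theta sw_mul; last by linearity.
rewrite exchange_tlift; apply: eq_tlift => b1 b2.
rewrite (morph_tlift _ _ (fun x y => mulrDl x y b2)); apply: eq_tlift => u v.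
by rewrite mul1r antipodeM scalerAl.
Qed.

Lemma trace_retraction_linear : linear trace_retraction.
Proof. by rewrite /trace_retraction /theta /g; linearity. Qed.

Lemma trace_retraction_mem h : trace_retraction h \in K.
Proof.
apply: K_sum => i; apply: sw_subalgebra_mem; [exact: g_mem|linearity|].
have [K0 _] := hopf_subalgebra_submod.
by move=> u v _ vK; rewrite -[_ *: _]addr0; apply: K_lin.
Qed.

(** [g_mul] and [theta_mul] spread [b] as b_1 inside [g], S(b_2) inside [theta] and b_3 on the
    right; [theta_trace] then joins the first two into b_1 S(b_2). *)
Lemma trace_retraction_mul h b :
  b \in K -> trace_retraction (h * b) = trace_retraction h * b.
Proof.
move=> bK.
transitivity (\sw_(b1, b' <- b) \sw_(b2, b3 <- b')
    \sum_i theta (antipode b2) i (g h (b1 * e i)) * b3).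
  rewrite /trace_retraction.
  under eq_bigr => i _.
    rewrite g_mul.
    have L : linear (theta 1 i) by rewrite /theta; linearity.
    rewrite (morph_tlift _ _ (linear_funD L)).
    under eq_tlift => b1 b' do rewrite theta_mul.
    over.
  rewrite -tlift_sumr; apply: eq_tlift => b1 b'.
  by rewrite -tlift_sumr.
transitivity (\sw_(b1, b' <- b) \sw_(b2, b3 <- b')
    \sum_i theta (b1 * antipode b2) i (g h (e i)) * b3).
  apply: sw_subalgebra_eq => //; try by rewrite /theta /g; linearity.
  move=> b1 b' b1K b'K.
  apply: sw_subalgebra_eq => //; try by rewrite /theta /g; linearity.
  move=> b2 b3 b2K b3K; rewrite -!mulr_suml theta_trace //.
  exact: K_antipode.
rewrite -(sw_coassoc (F := fun b1 b2 b3 =>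
    \sum_i theta (b1 * antipode b2) i (g h (e i)) * b3));
  try by rewrite /theta /g; linearity.
rewrite -[RHS](sw_counitl (G := fun b => trace_retraction h * b));
  last by linearity.
apply: eq_tlift => b' b3; rewrite /trace_retraction mulr_suml.
rewrite -(sw_antipoder (G := fun x => \sum_i theta x i (g h (e i)) * b3)) //.
by rewrite /theta; linearity.
Qed.

(** On [K] the map [g 1] is x_1 S(x_2) = eps(x), so the trace is the sum of c_i(1) eps(e_i), which
    is eps(1). With right linearity this makes the map the identity on [K]. *)
Lemma trace_retraction1 : trace_retraction 1 = 1.
Proof.
transitivity (\sum_i (c i 1 : k) *: (counit (e i) *: (1 : H))).
  apply: eq_bigr => i _.
  have -> : g 1 (e i) = counit (e i) *: 1.
    rewrite -[X in _ = _ *: X](_ : id 1 = 1) // -(sw_antipoder (G := id)) //.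
    apply: sw_subalgebra_eq; [exact: eK|linearity|linearity|].
    by move=> u v uK vK; rewrite mul1r rE.
  have L : linear (theta 1 i) by rewrite /theta; linearity.
  rewrite (linear_funZ _ _ L) scalerA mulrC -scalerA; congr (_ *: _).
  rewrite /theta; have [-> _] := comul_monoid_morphism (s := H).
  rewrite [X in tlift _ X]/(tpure 1 1) tlift_pure ?antipode1 ?mul1r //.
  by apply: bilin_tlift_balanced; linearity.
under eq_bigr do rewrite scalerA.
rewrite -scaler_suml -[RHS]scale1r; congr (_ *: _).
rewrite -(counit1 H) {2}(cE K_one) linear_sum; apply: eq_bigr => i _.
by rewrite linearZ.
Qed.

End Retraction.

End HopfSubalgebra.

(** * Normality from the retraction *)

Section Normality.

Variables (k : fieldType) (H : hopfAlgType k) (K : {pred H}).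
Hypotheses (hK : hopf_subalgebra K) (d2K : left_depth_two K).

Variable p : {linear H -> H}.
Hypothesis pM : forall h b, b \in K -> p (h * b) = p h * b.

(** The convolution of u |-> p(h u) with the antipode; [p_eq] undoes it by convolving with the
    identity. *)
Let G h u := \sw_(u1, u2 <- u) p (h * u1) * antipode u2.

Let p_eq h y : p (h * y) = \sw_(y1, y2 <- y) G h y1 * y2.
Proof.
transitivity (\sw_(y', y3 <- y) \sw_(y1, y2 <- y')
    p (h * y1) * antipode y2 * y3); last first.
  apply: eq_tlift => y1 y2.
  by rewrite (morph_tlift _ _ (fun u v => mulrDl u v y2)).
rewrite (sw_coassoc (F := fun y1 y2 y3 => p (h * y1) * antipode y2 * y3));
  try linearity.
rewrite -[LHS](sw_counitr (G := fun y => p (h * y))); last by linearity.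
apply: eq_tlift => y1 y'; rewrite -{1}[p _]mulr1.
rewrite -(sw_antipodel (G := fun u => p (h * y1) * u)); last by linearity.
by apply: eq_tlift => y2 y3; rewrite mulrA.
Qed.

(** Right linearity of [p] releases b_1 from p(h u_1 b_1), where it meets S(b_2) from S(u_2 b_2). *)
Let G_mulr h u b : b \in K -> G h (u * b) = counit b *: G h u.
Proof.
move=> bK; rewrite /G sw_mul; last by linearity.
rewrite (morph_tlift _ _ (scalerDr _)); apply: eq_tlift => u1 u2.
transitivity (\sw_(b1, b2 <- b) p (h * u1) * (b1 * antipode b2) * antipode u2).
  apply: (sw_subalgebra_eq hK) => //; try linearity.
  by move=> b1 b2 b1K _; rewrite antipodeM !mulrA pM.
rewrite (sw_antipoder (G := fun y => p (h * u1) * y * antipode u2)) ?mulr1 //.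
by linearity.
Qed.

(** Depth two enters here: it moves the invariance of [G h] from the right to the left. *)
Let G_mull h b u : b \in K -> G h (b * u) = counit b *: G h u.
Proof.
by apply: left_depth_two_invariant => //; [rewrite /G; linearity|exact: G_mulr].
Qed.

(** Apply [p_eq] to y = x a; left invariance replaces x_1 inside [G h] by its counit, leaving [x] on
    the right. *)
Let p_mul_subalgebra h x a :
  x \in K -> p (h * x * a) = \sw_(a1, a2 <- a) G h a1 * (x * a2).
Proof.
move=> xK; rewrite -mulrA p_eq sw_mul; last by rewrite /G; linearity.
transitivity (\sw_(x1, x2 <- x)
    counit x1 *: \sw_(a1, a2 <- a) G h a1 * (x2 * a2)).
  apply: (sw_subalgebra_eq hK) => //; try by rewrite /G; linearity.
  move=> x1 x2 x1K _; rewrite (morph_tlift _ _ (scalerDr _)).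
  by apply: eq_tlift => a1 a2; rewrite G_mull // scalerAl.
rewrite (sw_counitl (G := fun x => \sw_(a1, a2 <- a) G h a1 * (x * a2))) //.
by linearity.
Qed.

Lemma retraction_fixes_adjoint x a : p 1 = 1 -> x \in K ->
  p (\sw_(a1, a2 <- a) antipode a1 * x * a2) =
  \sw_(a1, a2 <- a) antipode a1 * x * a2.
Proof.
move=> p1 xK; have pL : linear p by linearity.
rewrite (morph_tlift _ _ (linear_funD pL)).
(* This is p(S(y_1) y_2) S(y_3), whose first factor collapses to p(1) = 1. *)
have GE y : \sw_(a1, a2 <- y) G (antipode a1) a2 = antipode y.
  rewrite /G -(sw_coassoc
    (F := fun a1 u1 u2 => p (antipode a1 * u1) * antipode u2));
    try linearity.
  rewrite -[RHS](sw_counitl (G := antipode)); last by linearity.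
  apply: eq_tlift => a' u2.
  rewrite (sw_antipodel (G := fun v => p v * antipode u2)); last by linearity.
  by rewrite p1 mul1r.
transitivity (\sw_(a1, a' <- a) \sw_(a2, a3 <- a')
    G (antipode a1) a2 * (x * a3)).
  by apply: eq_tlift => a1 a'; rewrite p_mul_subalgebra.
rewrite -(sw_coassoc (F := fun a1 a2 a3 => G (antipode a1) a2 * (x * a3)));
  try by rewrite /G; linearity.
apply: eq_tlift => a' a3.
by rewrite -mulrA -GE (morph_tlift _ _ (fun u v => mulrDl u v (x * a3))).
Qed.

End Normality.

Theorem theorem5p1 (k : closedFieldType) (char0 : [pchar k]%R =i pred0)
    (H : hopfAlgType k) (ssH : semisimple H)
    (K : {pred H}) (hK : hopf_subalgebra K) (d2K : depth_two K) :
  normal_hopf_subalgebra K.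
Proof.
split=> // a x xK; have KS := hopf_subalgebra_submod hK.
have [l [lE lK]] := coords_submod ssH KS.
pose e (i : 'I_(size l)) := (tnth (in_tuple l) i).1.
pose c (i : 'I_(size l)) := (tnth (in_tuple l) i).2.
have eK i : e i \in K.
  apply: lK; rewrite /e (tnth_nth (tnth (in_tuple l) i)) -(nth_map _ 0) //.
  by rewrite mem_nth ?size_map.
have lsum y : coord_sum l y = \sum_i (c i y : k) *: e i.
  by rewrite /coord_sum big_tnth.
have cE : {in K, forall y, y = \sum_i (c i y : k) *: e i}.
  by move=> y yK; rewrite -lsum lE.
(* The coordinates are valid on [K] and their vectors lie in [K], so the same formula on all of [H]
   is a linear projection onto [K]. *)
have [r rE] := linear_bundle (coord_sum_linear l).
have rK y : r y \in K.
  rewrite rE lsum; case: KS => K0 Klin.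
  apply: (big_ind (fun x => x \in K)) => // [u v uK vK|i _].
    by rewrite -[u]scale1r; apply: Klin.
  by rewrite -[_ *: _]addr0; apply: Klin.
have rid : {in K, forall y, r y = y} by move=> y yK; rewrite rE lE.
have [p pE] := linear_bundle (trace_retraction_linear e c r).
(* The element is fixed by [p], and all values of [p] lie in [K]. *)
rewrite -(@retraction_fixes_adjoint _ _ _ hK d2K.1 p) ?pE //.
- exact: (trace_retraction_mem hK).
- by move=> h b bK; rewrite !pE (trace_retraction_mul hK).
- exact: (trace_retraction1 hK eK cE rid).
Qed.
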